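(* Let $X$ be a Banach lattice and $1<p<\infty$, with $p^{\ast}$ defined by $1/p+1/p^{\ast}=1$. Then the Banach lattice $\ell_{p^{\ast},|\omega|}(X^{\ast})$ is lattice isomorphic and isometrically isomorphic to the dual $\left[\ell_{p}^{\pi}(X)\right]^{\ast}$ (via the map sending $(x_n^{\ast})_n$ to the functional $(x_n)_n\mapsto\sum_{n=1}^\infty x_n^{\ast}(x_n)$).
   Context: For a Banach lattice $X$, $X_+$ denotes its positive cone, $|x|=\sup\{x,-x\}$, and $X^{\ast}$ is the dual Banach lattice with order $x_1^{\ast}\le x_2^{\ast}$ iff $\langle x_1^{\ast},x\rangle\le\langle x_2^{\ast},x\rangle$ for all $x\in X_+$. For $1\le r<\infty$, $\ell_{r,|\omega|}(X^{\ast})$ is the space of sequences $(x_n^{\ast})_n$ in $X^{\ast}$ with $\sum_n\langle x,|x_n^{\ast}|\rangle^{r}<\infty$ for all $x\in X_+$, normed by $\|(x_n^{\ast})_n\|_{r,|\omega|}=\sup_{x\in B_X\cap X_+}(\sum_n\langle |x_n^{\ast}|,x\rangle^{r})^{1/r}$; it is a Banach lattice with the coordinatewise order. The space $\ell_p^{\pi}(X)$ (positive strongly $p$-summable sequences) consists of sequences $(x_n)_n$ in $X$ with $\sum_n|\langle x_n^{\ast},|x_n|\rangle|<\infty$ for every positive $(x_n^{\ast})_n\in\ell_{p^{\ast},|\omega|}(X^{\ast})$, with norm $\|(x_n)_n\|_{\ell_p^{\pi}(X)}=\sup\sum_{n}\langle x_n^{\ast},|x_n|\rangle$, the supremum over positive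 $(x_n^{\ast})_n$ in the closed unit ball of $\ell_{p^{\ast},|\omega|}(X^{\ast})$; it is a Banach lattice with coordinatewise order. *)

(* Defs.v *)
From HB Require Import structures.
From mathcomp Require Import all_boot all_order all_algebra.
From mathcomp Require Import all_classical all_reals all_analysis.
From Stdlib Require Import ClassicalEpsilon.
Set Implicit Arguments. Unset Strict Implicit. Unset Printing Implicit Defensive.
Import Order.TTheory GRing.Theory Num.Theory.
Import numFieldNormedType.Exports.
Local Open Scope classical_set_scope.
Local Open Scope ring_scope.

Section BanachLattice.
Variables (R : realType) (V : completeNormedModType R).

Record banach_lattice (le : V -> V -> Prop) (vsup : V -> V -> V) : Prop := {
  bl_refl : forall x, le x x;
  bl_trans : forall x y z, le x y -> le y z -> le x z;
  bl_antisym : forall x y, le x y -> le y x -> x = y;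
  bl_add : forall x y z, le x y -> le (x + z) (y + z);
  bl_scale : forall (a : R) x y, 0 <= a -> le x y -> le (a *: x) (a *: y);
  bl_sup_l : forall x y, le x (vsup x y);
  bl_sup_r : forall x y, le y (vsup x y);
  bl_sup_least : forall x y z, le x z -> le y z -> le (vsup x y) z;
  bl_norm : forall x y, le (vsup x (- x)) (vsup y (- y)) -> `|x| <= `|y|
}.

Variables (le : V -> V -> Prop) (vsup : V -> V -> V).

Definition vabs (x : V) : V := vsup x (- x).
Definition vpos (x : V) : Prop := le 0 x.

Definition dual_elt (f : V -> R) : Prop :=
  (forall (a : R) (x y : V), f (a *: x + y) = a * f x + f y) /\ continuous f.

Definition dle (f g : V -> R) : Prop := forall x, vpos x -> f x <= g x.

Definition is_dabs (f g : V -> R) : Prop :=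
  dual_elt g /\ dle f g /\ dle (fun x => - f x) g /\
  forall h, dual_elt h -> dle f h -> dle (fun x => - f x) h -> dle g h.

Definition dabs (f : V -> R) : V -> R :=
  ClassicalEpsilon.epsilon (inhabits (fun _ : V => 0 : R)) (is_dabs f).

Definition ellw (r : R) (xs : nat -> V -> R) : Prop :=
  (forall n, dual_elt (xs n)) /\
  forall x, vpos x -> cvgn (series (fun n => dabs (xs n) x `^ r)).

Definition ellw_norm (r : R) (xs : nat -> V -> R) : R :=
  sup [set (limn (series (fun n => dabs (xs n) x `^ r))) `^ r^-1
      | x in [set x | vpos x /\ `|x| <= 1]].

Definition dseq_pos (xs : nat -> V -> R) : Prop :=
  forall n, dle (fun _ => 0) (xs n).

(* ell_p^pi(X), with q = p^star *)
Definition ellpi (q : R) (xs : nat -> V) : Prop :=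
  forall ys : nat -> V -> R, ellw q ys -> dseq_pos ys ->
    cvgn (series (fun n => `| ys n (vabs (xs n)) |)).

Definition ellpi_norm (q : R) (xs : nat -> V) : R :=
  sup [set limn (series (fun n => ys n (vabs (xs n))))
      | ys in [set ys | ellw q ys /\ dseq_pos ys /\ ellw_norm q ys <= 1]].

(* The dual [ell_p^pi(X)]^star : linear functionals on the subspace ellpi q
   which are bounded (= continuous) for ellpi_norm.  Functionals are
   functions on all sequences, only their values on ellpi q matter. *)
Definition pidual (q : R) (phi : (nat -> V) -> R) : Prop :=
  (forall (a : R) (xs ys : nat -> V), ellpi q xs -> ellpi q ys ->
     phi (fun n => a *: xs n + ys n) = a * phi xs + phi ys) /\
  exists C : R, forall xs, ellpi q xs -> `|phi xs| <= C * ellpi_norm q xs.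

Definition pidual_norm (q : R) (phi : (nat -> V) -> R) : R :=
  sup [set `|phi xs| | xs in [set xs | ellpi q xs /\ ellpi_norm q xs <= 1]].

Definition pidle (q : R) (phi psi : (nat -> V) -> R) : Prop :=
  forall xs, ellpi q xs -> (forall n, vpos (xs n)) -> phi xs <= psi xs.

Definition is_piabs (q : R) (phi psi : (nat -> V) -> R) : Prop :=
  pidual q psi /\ pidle q phi psi /\ pidle q (fun xs => - phi xs) psi /\
  forall chi, pidual q chi -> pidle q phi chi ->
    pidle q (fun xs => - phi xs) chi -> pidle q psi chi.

Definition Tmap (ys : nat -> V -> R) : (nat -> V) -> R :=
  fun xs => limn (series (fun n => ys n (xs n))).

End BanachLattice.

(* Main.v *)
(* Write [|ys|] for the sequence of moduli, which exist and are approximated by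
   values of [ys n] on order intervals (Riesz-Kantorovich).  By Hoelder and its
   converse, the weak norm of [ys] is the least bound of the pairings of [|ys|]
   with the finite sequences [a_n x], [a] in the unit ball of l_p and [x] in the
   positive unit ball; the sequences [a_n u_n] with [|u_n| <= x] lie in the unit
   ball of l_p^pi and norm [ys], which gives the isometry.  A functional [phi]
   has coordinates [x |-> phi (x e_n)], weakly q-summable by the same test
   sequences, and it is determined by them because finite sequences are dense
   in l_p^pi: otherwise m disjoint blocks of unit-ball sequences, glued into one
   of norm at most m^(1/q), would pair with a fixed sequence to at least m e for
   every m.  The suprema defining both norms are finite by a gliding hump.  The
   lattice statement follows from surjectivity by testing on single entries. *)

Require Import Defs.
From HB Require Import structures.
From mathcomp Require Import all_boot all_order all_algebra.
From mathcomp Require Import all_classical all_reals all_analysis.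
From mathcomp Require Import ring lra.
From Stdlib Require ClassicalEpsilon.
Import Order.TTheory GRing.Theory Num.Theory.
Import numFieldNormedType.Exports.
Local Open Scope classical_set_scope.
Local Open Scope ring_scope.
Set Implicit Arguments. Unset Strict Implicit. Unset Printing Implicit Defensive.

(** * Nonnegative series, and Hoelder's inequality with its converse for finite sums *)

Section RealSequences.
Variable R : realType.
Implicit Types (u v a b F : nat -> R) (p q C : R).

Lemma nneg_series_cvg u M : (forall n, 0 <= u n) ->
  (forall N, \sum_(0 <= n < N) u n <= M) -> cvgn (series u).
Proof.
move=> u0 uM; apply: nondecreasing_is_cvgn.
  by apply: nondecreasing_series => n _ _; exact: u0.
by exists M => _ [N _ <-]; exact: uM.
Qed.

Lemma nneg_series_le_lim u N : (forall n, 0 <= u n) -> cvgn (series u) ->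
  \sum_(0 <= n < N) u n <= limn (series u).
Proof.
move=> u0 cu; apply: (@nondecreasing_cvgn_le _ (series u)) => //.
by apply: nondecreasing_series => n _ _; exact: u0.
Qed.

Lemma series_lim_le u M : cvgn (series u) ->
  (forall N, \sum_(0 <= n < N) u n <= M) -> limn (series u) <= M.
Proof. by move=> cu uM; apply: limr_le => //; apply: nearW => N; exact: uM. Qed.

Lemma abs_series_cvg u v : (forall n, `|u n| <= v n) -> cvgn (series v) ->
  cvgn (series u).
Proof.
move=> uv cv; apply: (@normed_cvg R R^o u).
apply: (series_le_cvg _ _ _ cv) => [n|n|n] /=; rewrite ?normr_ge0//.
exact: le_trans (uv n).
Qed.

Lemma lim_series_abs_le u v : (forall n, `|u n| <= v n) -> cvgn (series v) ->
  `|limn (series u)| <= limn (series v).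
Proof.
move=> uv cv; have cu := abs_series_cvg uv cv.
rewrite ler_norml -lim_seriesN//; apply/andP; split; apply: lim_series_le => //.
- by rewrite is_cvg_seriesN.
- by move=> n; move: (uv n); rewrite ler_norml => /andP[].
- by move=> n; move: (uv n); rewrite ler_norml => /andP[].
Qed.

Lemma half_geometric_le (N : nat) : \sum_(0 <= k < N) 2^-1 ^+ k.+1 <= 1 :> R.
Proof.
suff -> : \sum_(0 <= k < N) 2^-1 ^+ k.+1 = 1 - 2^-1 ^+ N :> R.
  by rewrite gerBl exprn_ge0// invr_ge0.
elim: N => [|N IH]; first by rewrite big_geq// expr0 subrr.
rewrite big_nat_recr//= IH exprS; lra.
Qed.

Lemma half_geometric_cvg : cvgn (series (fun k => 2^-1 ^+ k.+1 : R)).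
Proof.
by apply: nneg_series_cvg half_geometric_le => n; rewrite exprn_ge0// invr_ge0.
Qed.

Lemma expr2_unbounded (M : R) : exists k, M < 2 ^+ k.
Proof.
exists (Num.truncn `|M|).+1; apply: le_lt_trans (ler_norm _) _.
apply: (lt_trans (truncnS_gt _)).
by rewrite -natrX ltr_nat ltn_expl.
Qed.

Lemma conj_exp_gt1 p q : 1 < p -> p^-1 + q^-1 = 1 -> 1 < q.
Proof.
move=> p1 pq; have p0 : 0 < p by lra.
have ip1 : p^-1 < 1 by rewrite invf_lt1.
have ip0 : 0 < p^-1 by rewrite invr_gt0.
have iq0 : 0 < q^-1 by lra.
by rewrite -invf_lt1 -1?invr_gt0//; lra.
Qed.

Lemma powRV (x r : R) : 0 <= x -> x^-1 `^ r = (x `^ r)^-1.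
Proof. by move=> x0; rewrite -(powR_inv1 x0) powRAC powR_inv1// powR_ge0. Qed.

(** Young's inequality applied termwise to [a n] and [b n / C]; the two sums contribute at most 1/p
    and 1/q. *)
Lemma finite_hoelder p q C a b N : 1 < p -> p^-1 + q^-1 = 1 -> 0 <= C ->
  (forall n, 0 <= a n) -> (forall n, 0 <= b n) ->
  \sum_(0 <= n < N) a n `^ p <= 1 -> \sum_(0 <= n < N) b n `^ q <= C `^ q ->
  \sum_(0 <= n < N) a n * b n <= C.
Proof.
move=> p1 pq C0 a0 b0 ha hb.
have q1 := conj_exp_gt1 p1 pq.
(* The normalisation by [C] needs [C > 0]; for [C = 0] the hypothesis on [b] forces every relevant
   [b n] to vanish. *)
move: C0; rewrite le_eqVlt => /predU1P[C0|C0]; last first.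
  have -> : \sum_(0 <= n < N) a n * b n = C * \sum_(0 <= n < N) a n * (b n / C).
    rewrite mulr_sumr; apply: eq_bigr => i _.
    by rewrite mulrCA [C * _]mulrC divfK// gt_eqF.
  rewrite ler_piMr ?(ltW C0)//.
  apply: (@le_trans _ _ (\sum_(0 <= n < N) (a n `^ p / p + (b n / C) `^ q / q))).
    apply: ler_sum => i _; apply: conjugate_powR => //; try lra.
    by rewrite divr_ge0// ltW.
  rewrite big_split /= -!mulr_suml -pq.
  have ip : 0 <= p^-1 by rewrite invr_ge0; lra.
  have iq : 0 <= q^-1 by rewrite invr_ge0; lra.
  rewrite lerD//; first by rewrite ler_piMl.
  rewrite ler_piMl//.
  have -> : \sum_(0 <= i < N) (b i / C) `^ q = (\sum_(0 <= i < N) b i `^ q) / C `^ q.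
    rewrite mulr_suml; apply: eq_bigr => i _.
    by rewrite powRM ?invr_ge0 ?(ltW C0)// powRV// ltW.
  by rewrite ler_pdivrMr ?powR_gt0// mul1r.
rewrite -C0 powR0 in hb; last by lra.
rewrite big_nat big1 -?C0// => i /andP[_ iN].
suff -> : b i = 0 by rewrite mulr0.
apply/(@powR_eq0_eq0 _ _ q)/le_anti; rewrite powR_ge0 andbT.
apply: le_trans hb; rewrite (bigD1_seq i) ?mem_index_iota ?iota_uniq//=.
by rewrite lerDl sumr_ge0// => j _; exact: powR_ge0.
Qed.

Lemma finite_hoelder_conv p q C b N : 1 < p -> p^-1 + q^-1 = 1 ->
  (forall n, 0 <= b n) ->
  (forall a, (forall n, 0 <= a n) -> \sum_(0 <= n < N) a n `^ p <= 1 ->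
     \sum_(0 <= n < N) a n * b n <= C) ->
  \sum_(0 <= n < N) b n `^ q <= C `^ q.
Proof.
move=> p1 pq b0 hab; have q1 := conj_exp_gt1 p1 pq.
set S := \sum_(0 <= n < N) b n `^ q.
have S0 : 0 <= S by apply: sumr_ge0 => i _; exact: powR_ge0.
move: S0; rewrite le_eqVlt => /predU1P[<-|S0]; first exact: powR_ge0.
have p0 : p != 0 by lra.
have q0 : q != 0 by lra.
have qp : (q - 1) * p = q.
  have : p + q = p * q by rewrite -[RHS]mul1r -pq; field; apply/andP.
  lra.
have -> : S = S `^ q^-1 `^ q by rewrite -powRrM mulVf// powRr1// ltW.
apply: ge0_ler_powR; rewrite ?nnegrE ?powR_ge0//; try lra.
  (* Testing with the zero sequence shows [0 <= C]. *)
  apply: le_trans (hab (fun _ => 0) _ _) => //.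
    by rewrite big1// => i _; rewrite mul0r.
  by rewrite big1// => i _; rewrite powR0.
(* The equality case of Hoelder: since (q - 1) p = q, this sequence has p-sum 1, and it pairs with
   [b] to S^(1 - 1/p) = S^(1/q). *)
apply: le_trans (hab (fun n => b n `^ (q - 1) / S `^ p^-1) _ _).
- have -> : \sum_(0 <= n < N) b n `^ (q - 1) / S `^ p^-1 * b n = S / S `^ p^-1.
    rewrite {3}/S mulr_suml; apply: eq_bigr => i _.
    by rewrite mulrAC [_ * b i]mulrC mulr_powRB1//; lra.
  have -> : q^-1 = 1 - p^-1 by lra.
  by rewrite powRB ?(gt_eqF S0) ?implybT// powRr1// ltW.
- by move=> n; rewrite divr_ge0// powR_ge0.
- have -> : \sum_(0 <= n < N) (b n `^ (q - 1) / S `^ p^-1) `^ p = S / S.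
    rewrite {2}/S mulr_suml; apply: eq_bigr => i _.
    rewrite powRM ?powR_ge0 ?invr_ge0 ?powR_ge0// -powRrM qp.
    by rewrite -powRN -powRrM mulNr mulVf// powRN powRr1// ltW.
  by rewrite divff// gt_eqF.
Qed.

Lemma sum_nneg_mono F M N : (forall n, 0 <= F n) -> (M <= N)%N ->
  \sum_(0 <= n < M) F n <= \sum_(0 <= n < N) F n.
Proof.
by move=> F0 MN; apply: (nondecreasing_series (P := xpredT) (m := 0)) => // n _ _.
Qed.

Lemma sum_trunc_le F M N : (forall n, 0 <= F n) ->
  \sum_(0 <= n < M) (if (n < N)%N then F n else 0) <= \sum_(0 <= n < N) F n.
Proof.
move=> F0; have [MN|NM] := leqP M N.
  apply: le_trans (sum_nneg_mono F0 MN).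
  by apply: ler_sum => n _; case: ifP.
by rewrite -big_mkcond [leRHS](big_nat_widen _ _ M) ?(ltnW NM).
Qed.

Lemma term_le_sum F n N : (forall n, 0 <= F n) -> (n < N)%N ->
  F n <= \sum_(0 <= n < N) F n.
Proof.
move=> F0 nN; rewrite (bigD1_seq n) ?mem_index_iota ?iota_uniq//=.
by rewrite lerDl sumr_ge0.
Qed.

Lemma le_eps_mul (S c M : R) : 0 <= M -> (forall e, 0 < e -> S <= c + e * M) ->
  S <= c.
Proof.
move=> M0 h; apply/ler_addgt0Pr => e e0.
have M1 : 0 < M + 1 by lra.
apply: (le_trans (h (e / (M + 1)) _)); first by rewrite divr_gt0.
rewrite lerD2l mulrAC ler_pdivrMr// ler_wpM2l ?ltW//; lra.
Qed.

End RealSequences.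

(** * Order, modulus and norm in a Banach lattice *)

Section BanachLatticeTheory.
Variables (R : realType) (V : completeNormedModType R).
Variables (le : V -> V -> Prop) (vsup : V -> V -> V).
Hypothesis BL : banach_lattice le vsup.
Implicit Types (x y z u : V) (f g : V -> R).

Local Notation "x '<~' y" := (le x y) (at level 70).
Local Notation vpos := (vpos le).
Local Notation vabs := (vabs vsup).

Lemma vle_refl x : x <~ x. Proof. exact: (bl_refl BL). Qed.

Lemma vle_trans y x z : x <~ y -> y <~ z -> x <~ z.
Proof. exact: (bl_trans BL). Qed.

Lemma vle_subr0 x y : x <~ y <-> vpos (y - x).
Proof.
split=> xy; first by have := bl_add BL (- x) xy; rewrite subrr.
by have := bl_add BL x xy; rewrite add0r subrK.
Qed.

Lemma vpos0 : vpos 0. Proof. exact: vle_refl. Qed.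

Lemma vposD x y : vpos x -> vpos y -> vpos (x + y).
Proof.
move=> x0 y0; apply: (vle_trans y0).
by have := bl_add BL y x0; rewrite add0r.
Qed.

Lemma vposZ (a : R) x : 0 <= a -> vpos x -> vpos (a *: x).
Proof. by move=> a0 /(bl_scale BL a0); rewrite scaler0. Qed.

Lemma vleD x y z u : x <~ y -> z <~ u -> (x + z) <~ (y + u).
Proof.
rewrite !vle_subr0 => xy zu; have := vposD xy zu.
by rewrite opprD addrACA.
Qed.

Lemma vleN x y : x <~ y -> (- y) <~ (- x).
Proof. by rewrite !vle_subr0 opprK addrC. Qed.

Lemma vle_subl x y z : (x - z) <~ y <-> x <~ (y + z).
Proof. by rewrite !vle_subr0 opprB addrA. Qed.

Lemma vle_absr x : x <~ vabs x. Proof. exact: (bl_sup_l BL). Qed.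

Lemma vle_absNr x : (- x) <~ vabs x. Proof. exact: (bl_sup_r BL). Qed.

Lemma vabs_le x y : x <~ y -> (- x) <~ y -> vabs x <~ y.
Proof. exact: (bl_sup_least BL). Qed.

Lemma vpos_double x : vpos (x + x) -> vpos x.
Proof.
move=> x0; have := @vposZ 2^-1 (x + x); rewrite scalerDr -scalerDl => h.
by have := h _ x0; rewrite (_ : 2^-1 + 2^-1 = 1) ?scale1r; [apply; rewrite invr_ge0|lra].
Qed.

Lemma vabs_ge0 x : vpos (vabs x).
Proof.
apply: vpos_double; have := vleD (vle_absr x) (vle_absNr x).
by rewrite subrr.
Qed.

Lemma vabs_pos x : vpos x -> vabs x = x.
Proof.
move=> x0; apply: (bl_antisym BL); last exact: vle_absr.
apply: vabs_le; first exact: vle_refl.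
by have := vleN x0; rewrite oppr0 => /vle_trans; apply.
Qed.

Lemma vabs0 : vabs 0 = 0. Proof. exact/vabs_pos/vpos0. Qed.

Lemma norm_vabs x : `|vabs x| = `|x|.
Proof.
have h : vsup (vabs x) (- vabs x) = vsup x (- x) by exact/vabs_pos/vabs_ge0.
by apply/le_anti/andP; split; apply: (bl_norm BL); rewrite h; exact: vle_refl.
Qed.

Lemma norm_vle x y : vpos x -> x <~ y -> `|x| <= `|y|.
Proof.
move=> x0 xy; apply: (bl_norm BL).
rewrite -/(vabs x) -/(vabs y) vabs_pos//.
exact: vle_trans xy (vle_absr y).
Qed.

(** The negative part of [l] lies below the modulus of [l - s n], so its norm is arbitrarily small
    and it vanishes. *)
Lemma vpos_cvg (s : nat -> V) l :
  (forall n, vpos (s n)) -> s @ \oo --> l -> vpos l.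
Proof.
move=> s0 sl.
have neg n : vpos (vsup (- l) 0) /\ `|vsup (- l) 0| <= `|l - s n|.
  have h0 : vpos (vsup (- l) 0) by exact: (bl_sup_r BL).
  split=> //; rewrite -(norm_vabs (l - s n)); apply: norm_vle => //.
  apply: (bl_sup_least BL); last exact: vabs_ge0.
  apply: vle_trans (vle_absNr _); rewrite opprB.
  by rewrite vle_subr0 opprK subrK; exact: s0.
suff : vsup (- l) 0 = 0.
  have := bl_sup_l BL (- l) 0; move=> /[swap] -> /vleN.
  by rewrite oppr0 opprK.
apply/normr0_eq0/le_anti; rewrite normr_ge0 andbT.
apply/ler_addgt0Pr => e e0; rewrite add0r.
move/cvgrPdist_le : sl => /(_ e e0) [N _ /(_ N (leqnn N))] /=.
exact: le_trans (neg N).2.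
Qed.

Lemma vle_cvg (s : nat -> V) l x : (forall n, x <~ s n) -> s @ \oo --> l ->
  x <~ l.
Proof.
move=> xs sl; apply: (vle_subr0 _ _).2; apply: (@vpos_cvg (fun n => s n - x)).
  by move=> n; apply: (vle_subr0 _ _).1; exact: xs.
by apply: cvgB => //; exact: cvg_cst.
Qed.

Definition pospart x := vsup x 0.

Lemma pospart_ge0 x : vpos (pospart x). Proof. exact: (bl_sup_r BL). Qed.

Lemma pospart_subN x : pospart x - pospart (- x) = x.
Proof.
suff -> : pospart (- x) = pospart x - x by rewrite opprB addrC subrK.
have lex : x <~ pospart x by exact: (bl_sup_l BL).
apply: (bl_antisym BL).
  apply: (bl_sup_least BL); last exact: (vle_subr0 _ _).1.
  by apply: (vle_subr0 _ _).2; rewrite opprK subrK; exact: pospart_ge0.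
apply/vle_subl; apply: (bl_sup_least BL).
  by have := bl_add BL x (pospart_ge0 (- x)); rewrite add0r.
by apply/vle_subl; rewrite sub0r; exact: (bl_sup_l BL).
Qed.

Lemma norm_pospart x : `|pospart x| <= `|x|.
Proof.
rewrite -(norm_vabs x); apply: norm_vle; first exact: pospart_ge0.
by apply: (bl_sup_least BL); [exact: vle_absr|exact: vabs_ge0].
Qed.

(** The truncation of [y] to the order interval [-x1, x1] serves as [z]. *)
Lemma riesz_decomposition x1 x2 y : vpos x1 -> vpos x2 ->
  vabs y <~ (x1 + x2) ->
  exists2 z, vabs z <~ x1 & vabs (y - z) <~ x2.
Proof.
move=> x10 x20 yx.
have yx1 := vle_trans (vle_absr y) yx; have yx2 := vle_trans (vle_absNr y) yx.
have negx1 : (- x1) <~ x1.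
  by have := vleN x10; rewrite oppr0 => /vle_trans; apply.
(* The infimum of [y] and [x1], expressed through the supremum. *)
pose m := - vsup (- y) (- x1).
have my : m <~ y by have /vleN := bl_sup_l BL (- y) (- x1); rewrite opprK.
have mx1 : m <~ x1 by have /vleN := bl_sup_r BL (- y) (- x1); rewrite opprK.
have mI z : z <~ y -> z <~ x1 -> z <~ m.
  move=> /vleN zy /vleN zx; rewrite -(opprK z); apply: vleN.
  exact: (bl_sup_least BL).
exists (vsup (- x1) m).
  apply: vabs_le; first exact: (bl_sup_least BL).
  by have /vleN := bl_sup_l BL (- x1) m; rewrite opprK.
apply: vabs_le.
  apply/vle_subl; rewrite addrC; apply/vle_subl.
  apply: vle_trans (bl_sup_r BL _ _); apply: mI.
    by apply/vle_subl; have := vleD (vle_refl y) x20; rewrite addr0.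
  exact/vle_subl.
rewrite opprB; apply/vle_subl; rewrite addrC; apply: (bl_sup_least BL).
  move/vleN: yx2; rewrite opprK opprD => /(bl_add BL x2).
  by rewrite subrK.
apply: (vle_trans my).
by have := vleD (vle_refl y) x20; rewrite addr0.
Qed.

(** * Continuous functionals and their boundedness *)

Lemma dual_eltD f x y : dual_elt f -> f (x + y) = f x + f y.
Proof. by case=> lf _; have := lf 1 x y; rewrite scale1r mul1r. Qed.

Lemma dual_elt0 f : dual_elt f -> f 0 = 0.
Proof.
by move=> df; have := dual_eltD 0 0 df; rewrite addr0 => h; lra.
Qed.

Lemma dual_eltZ f (a : R) x : dual_elt f -> f (a *: x) = a * f x.
Proof.
by move=> df; have := df.1 a x 0; rewrite !addr0 (dual_elt0 df) addr0.
Qed.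

Lemma dual_eltN f x : dual_elt f -> f (- x) = - f x.
Proof. by move=> df; rewrite -scaleN1r dual_eltZ// mulN1r. Qed.

Lemma dual_eltB f x y : dual_elt f -> f (x - y) = f x - f y.
Proof. by move=> df; rewrite dual_eltD// dual_eltN. Qed.

Lemma dual_elt_bounded f : dual_elt f ->
  exists2 K, 0 <= K & forall x, `|f x| <= K * `|x|.
Proof.
move=> df; have := df.2 0 => /cvgrPdist_le /(_ 1 ltr01) /nbhs_normP [d /= d0 h].
exists (2 / d); first by rewrite divr_ge0// ltW.
move=> x; have [->|x0] := eqVneq x 0.
  by rewrite (dual_elt0 df) !normr0 mulr0.
have nx0 : 0 < `|x| by rewrite normr_gt0.
(* Rescales [x] to norm d/2, strictly inside the ball of radius [d] on which [f] is bounded by 1. *)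
pose c := d / 2 / `|x|.
have c0 : 0 < c by rewrite !divr_gt0.
have cx : c * `|x| = d / 2 by rewrite /c divfK// gt_eqF.
have := h (c *: x); rewrite /ball_ /= (dual_elt0 df) !sub0r !normrN.
rewrite normrZ (gtr0_norm c0) cx (dual_eltZ _ _ df) normrM (gtr0_norm c0).
have d2 : d / 2 < d by lra.
move=> /(_ d2); rewrite -ler_pdivlMl// => /le_trans; apply.
rewrite le_eqVlt; apply/orP; left; apply/eqP.
by rewrite /c; field; rewrite !gt_eqF.
Qed.

Lemma bounded_dual_elt f K :
  (forall (a : R) x y, f (a *: x + y) = a * f x + f y) ->
  (forall x, `|f x| <= K * `|x|) -> dual_elt f.
Proof.
move=> lf fK; split=> // x; apply/cvgrPdist_le => e e0.
have K1 : 0 < `|K| + 1 by rewrite ltr_wpDl.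
apply/nbhs_normP; exists (e / (`|K| + 1)); first by rewrite /= divr_gt0.
move=> y /=; rewrite ltr_pdivlMr// => h.
have -> : f x - f y = f (x - y).
  by rewrite [x - y]addrC -(scaleN1r y) lf mulN1r addrC.
apply: (le_trans (fK _)); apply: le_trans (ltW h).
by rewrite mulrC ler_wpM2l// (le_trans (ler_norm _))// lerDl.
Qed.

Lemma pos_dual_mono f x y : dual_elt f -> dle le (fun _ => 0) f ->
  x <~ y -> f x <= f y.
Proof.
by move=> df f0 /vle_subr0/f0; rewrite dual_eltB// subr_ge0.
Qed.

(** * The modulus of a continuous functional, by the Riesz-Kantorovich formula *)

Section Modulus.
Variable f : V -> R.
Hypothesis df : dual_elt f.

Let S x : set R := [set f y | y in [set y | vabs y <~ x]].
Let m x := sup (S x).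

Let S_ub K x : 0 <= K -> (forall x, `|f x| <= K * `|x|) ->
  ubound (S x) (K * `|x|).
Proof.
move=> K0 fK _ [y yx <-]; rewrite (le_trans (ler_norm _))// (le_trans (fK y))//.
rewrite ler_wpM2l// -(norm_vabs y); apply: norm_vle => //; exact: vabs_ge0.
Qed.

Let S_has_sup x : vpos x -> has_sup (S x).
Proof.
move=> x0; split; first by exists (f 0), 0 => //=; rewrite vabs0.
by have [K K0 fK] := dual_elt_bounded df; exists (K * `|x|); exact: S_ub.
Qed.

Let m_ub x y : vpos x -> vabs y <~ x -> f y <= m x.
Proof. by move=> x0 yx; apply: (ub_le_sup (S_has_sup x0).2); exists y. Qed.

Let m_lub x c : vpos x -> (forall y, vabs y <~ x -> f y <= c) -> m x <= c.
Proof.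
by move=> x0 h; apply: (ge_sup (S_has_sup x0).1) => _ [y yx <-]; exact: h.
Qed.

Let m0 x : vpos x -> 0 <= m x.
Proof. by move=> x0; rewrite -(dual_elt0 df); apply: m_ub => //; rewrite vabs0. Qed.

(** Subadditivity is the Riesz decomposition; superadditivity comes from adding elements of the two
    order intervals. *)
Let mD x y : vpos x -> vpos y -> m (x + y) = m x + m y.
Proof.
move=> x0 y0; have xy0 := vposD x0 y0; apply/le_anti/andP; split.
  apply: m_lub => // z zxy; have [u ux zu] := riesz_decomposition x0 y0 zxy.
  by rewrite -(subrK u z) addrC dual_eltD// lerD// m_ub.
rewrite -lerBrDr; apply: m_lub => // z zx.
rewrite lerBrDr addrC -lerBrDr; apply: m_lub => // u uy.
rewrite lerBrDr -dual_eltD//; apply: m_ub => //; apply: vabs_le.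
  rewrite addrC; apply: vleD; [exact: vle_trans (vle_absr _) _|].
  exact: vle_trans (vle_absr _) _.
rewrite opprD addrC; apply: vleD; [exact: vle_trans (vle_absNr _) _|].
exact: vle_trans (vle_absNr _) _.
Qed.

Let mZ_le (a : R) x : 0 < a -> vpos x -> a * m x <= m (a *: x).
Proof.
move=> a0 x0; have ax0 := vposZ (ltW a0) x0.
rewrite -ler_pdivlMl//; apply: m_lub => // y yx.
rewrite ler_pdivlMl// -dual_eltZ//; apply: m_ub => //; apply: vabs_le.
  by apply: (bl_scale BL (ltW a0)); exact: vle_trans (vle_absr _) _.
rewrite -scalerN; apply: (bl_scale BL (ltW a0)).
exact: vle_trans (vle_absNr _) _.
Qed.

Let mZ (a : R) x : 0 <= a -> vpos x -> m (a *: x) = a * m x.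
Proof.
rewrite le_eqVlt => /predU1P[<- x0|a0 x0].
  rewrite scale0r mul0r; have := mD vpos0 vpos0; rewrite addr0 => h; lra.
apply/le_anti/andP; split; last exact: mZ_le.
have ia0 : 0 < a^-1 by rewrite invr_gt0.
rewrite -ler_pdivrMl//; apply: le_trans (mZ_le ia0 _) _.
  by apply: vposZ => //; exact: ltW.
by rewrite scalerA mulVf ?scale1r// gt_eqF.
Qed.

Let g x := m (pospart x) - m (pospart (- x)).

(** The extension of [m] does not depend on how a vector is split into a difference of positive
    ones; linearity of [g] follows from this. *)
Let gE x y : vpos x -> vpos y -> g (x - y) = m x - m y.
Proof.
move=> x0 y0; rewrite /g; set z := x - y.
have e : pospart z + y = x + pospart (- z).
  by apply/eqP; rewrite -subr_eq addrAC pospart_subN subrK.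
have := congr1 m e; rewrite !mD//; try exact: pospart_ge0; lra.
Qed.

Let gpos x : vpos x -> g x = m x.
Proof.
move=> x0; rewrite -{1}(subr0 x) gE//; last exact: vpos0.
have := mZ (lexx 0) vpos0; rewrite scaler0 mul0r => ->; exact: subr0.
Qed.

(** The supremum of [f] over [-x, x] is additive and positively homogeneous on the cone, hence
    extends linearly. The second clause records that the supremum is approached, which later yields
    the test sequences for the weak norm. *)
Lemma riesz_kantorovich : exists2 h, is_dabs le f h &
  forall x, vpos x ->
    forall e : R, 0 < e -> exists2 y, vabs y <~ x & h x - e < f y.
Proof.
have gD x y : g (x + y) = g x + g y.
  rewrite -{1}(pospart_subN x) -{1}(pospart_subN y) addrACA -opprD gE ?mD//;
    try (by apply: vposD; exact: pospart_ge0); try exact: pospart_ge0.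
  by rewrite opprD addrACA.
have gN x : g (- x) = - g x by rewrite /g opprK opprB.
have gZ0 (a : R) x : 0 <= a -> g (a *: x) = a * g x.
  move=> a0; rewrite -{1}(pospart_subN x) scalerBr gE ?mZ -?mulrBr//;
    try exact: pospart_ge0; by apply: vposZ => //; exact: pospart_ge0.
have gZ (a : R) x : g (a *: x) = a * g x.
  have [a0|a0] := leP 0 a; first exact: gZ0.
  by rewrite -(opprK a) scaleNr gN gZ0 ?mulNr// oppr_ge0 ltW.
exists g; last first.
  move=> x x0 e e0; rewrite gpos//.
  by have [_ [y yx <-] ?] := sup_adherent e0 (S_has_sup x0); exists y.
split; last split; last split.
- have [K K0 fK] := dual_elt_bounded df.
  apply: (@bounded_dual_elt _ (K + K)) => [a x y|x]; first by rewrite gD gZ.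
  have h y : `|m (pospart y)| <= K * `|y|.
    rewrite ger0_norm ?m0//; last exact: pospart_ge0.
    apply: (@le_trans _ _ (K * `|pospart y|)).
      by apply: ge_sup; [exact: (S_has_sup (pospart_ge0 y)).1|exact: S_ub].
    by rewrite ler_wpM2l// norm_pospart.
  apply: (le_trans (ler_normB _ _)); rewrite mulrDl lerD//.
  by rewrite (le_trans (h _))// normrN.
- by move=> x x0; rewrite gpos//; apply: m_ub => //; rewrite vabs_pos//; exact: vle_refl.
- move=> x x0; rewrite gpos// -dual_eltN//; apply: m_ub => //.
  apply: vabs_le; last by rewrite opprK; exact: vle_refl.
  by have := vleN x0; rewrite oppr0 => /vle_trans; apply.
(* Minimality: adding f <= h at x + y and -f <= h at x - y gives 2 f(y) <= 2 h(x). *)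
- move=> h dh fh Nfh x x0; rewrite gpos//; apply: m_lub => // y yx.
  have xy1 : vpos (x + y).
    by rewrite -[y]opprK; apply: (vle_subr0 _ _).1; exact: vle_trans (vle_absNr _) _.
  have xy2 : vpos (x - y) by apply: (vle_subr0 _ _).1; exact: vle_trans (vle_absr _) _.
  have := fh _ xy1; have := Nfh _ xy2.
  rewrite !dual_eltD// !dual_eltN//; lra.
Qed.

End Modulus.

End BanachLatticeTheory.

Section SequenceSpaces.
Variables (R : realType) (V : completeNormedModType R).
Variables (le : V -> V -> Prop) (vsup : V -> V -> V) (p q : R).
Hypothesis BL : banach_lattice le vsup.
Hypotheses (p1 : 1 < p) (pq : p^-1 + q^-1 = 1).
Implicit Types (x y z u : V) (f g : V -> R) (ys zs : nat -> V -> R).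
Implicit Types (xs : nat -> V).

Local Notation "x '<~' y" := (le x y) (at level 70).
Local Notation vpos := (vpos le).
Local Notation vabs := (vabs vsup).
Local Notation dabs := (dabs le).

Let q1 : 1 < q := conj_exp_gt1 p1 pq.
Let q0 : 0 < q. Proof. by have := q1; lra. Qed.

(** * The chosen modulus [dabs] *)

Lemma dabsP f : dual_elt f -> is_dabs le f (dabs f).
Proof.
move=> df; apply: ClassicalEpsilon.epsilon_spec.
by have [h hP _] := riesz_kantorovich BL df; exists h.
Qed.

(** Minimality in both directions gives agreement on the cone, which spans the space. This
    identifies the chosen [dabs f] with any modulus constructed by hand. *)
Lemma is_dabs_uniq f g h : is_dabs le f g -> is_dabs le f h -> g = h.
Proof.
move=> [dg [fg [Nfg ming]]] [dh [fh [Nfh minh]]].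
have gh x : vpos x -> g x = h x.
  by move=> x0; apply/le_anti; rewrite ming// minh.
apply/funext => x; rewrite -(pospart_subN BL x).
by rewrite !(dual_eltB _ _ dg) !(dual_eltB _ _ dh) !gh//; exact: (pospart_ge0 BL).
Qed.

Lemma dabs_dual f : dual_elt f -> dual_elt (dabs f).
Proof. by case/dabsP. Qed.

Lemma dabs_ge0 f : dual_elt f -> dle le (fun _ => 0) (dabs f).
Proof.
by move=> /dabsP[_ [h1 [h2 _]]] x x0; have := h1 x x0; have := h2 x x0; lra.
Qed.

Lemma dabs_pos f : dual_elt f -> dle le (fun _ => 0) f -> dabs f = f.
Proof.
move=> df f0; apply: (is_dabs_uniq (dabsP df)); split=> //; split=> //.
split=> [x x0|h _ fh _ //]; have := f0 x x0; lra.
Qed.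

Lemma dabs_approx f x (e : R) : dual_elt f -> vpos x -> 0 < e ->
  exists2 y, vabs y <~ x & dabs f x - e < f y.
Proof.
move=> df x0 e0; have [h hP happ] := riesz_kantorovich BL df.
by rewrite (is_dabs_uniq (dabsP df) hP); exact: happ.
Qed.

(** The modulus dominates [f] and [-f] at the positive vectors |y| - y and |y| + y; suitable pairs
    of these inequalities are added. *)
Lemma abs_le_dabs f y : dual_elt f -> `|f y| <= dabs f (vabs y).
Proof.
move=> df; have [dh [fh [Nfh _]]] := dabsP df.
have h1 : vpos (vabs y - y) by apply: (vle_subr0 BL _ _).1; exact: (vle_absr BL).
have h2 : vpos (vabs y + y).
  by rewrite -[y in _ + y]opprK; apply: (vle_subr0 BL _ _).1; exact: (vle_absNr BL).
have := fh _ h1; have := Nfh _ h1; have := fh _ h2; have := Nfh _ h2.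
rewrite !(dual_eltB _ _ df) !(dual_eltD _ _ df) !(dual_eltB _ _ dh) !(dual_eltD _ _ dh).
rewrite ler_norml => *; apply/andP; split; lra.
Qed.

(** * Weakly summable sequences of functionals and their norm *)

Definition pdual ys := (forall n, dual_elt (ys n)) /\ dseq_pos le ys.

Definition absseq ys : nat -> V -> R := fun n => dabs (ys n).

(* For positive [ys], this says that the weak norm of [ys] is at most [C], but
   stays meaningful without knowing that suprema and series are finite; [pbnd]
   below plays the same role for the norm of l_p^pi. *)
Definition wbnd (C : R) ys := forall x, vpos x -> `|x| <= 1 ->
  forall N, \sum_(0 <= n < N) ys n x `^ q <= C `^ q.

Lemma pdual_absseq ys : (forall n, dual_elt (ys n)) -> pdual (absseq ys).
Proof. by move=> dy; split=> n; [exact: dabs_dual|exact: dabs_ge0]. Qed.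

Lemma absseq_pos ys : pdual ys -> absseq ys = ys.
Proof. by case=> dy y0; apply/funext => n; rewrite /absseq dabs_pos. Qed.

Lemma pdual_ge0 ys n x : pdual ys -> vpos x -> 0 <= ys n x.
Proof. by move=> [_]; apply. Qed.

(* Gliding hump: if [x_k] violates the bound 4^k, then the sum of the [2^-k x_k]
   has a divergent series. *)
Lemma ellw_bounded ys : ellw le q ys -> exists2 C, 0 <= C & wbnd C (absseq ys).
Proof.
move=> [dy cy]; apply: contrapT => unb.
have pA := pdual_absseq dy.
have hump k : exists xN : V * nat, [/\ vpos xN.1, `|xN.1| <= 1 &
    (4 ^+ k.+1) `^ q < \sum_(0 <= n < xN.2) absseq ys n xN.1 `^ q].
  apply: contrapT => nh; apply: unb; exists (4 ^+ k.+1); first by rewrite exprn_ge0.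
  move=> x x0 nx N; rewrite leNgt; apply/negP => h; apply: nh.
  by exists (x, N).
have [xN hxN] := choice hump.
pose v k := 2^-1 ^+ k.+1 *: (xN k).1.
have v0 k : vpos (v k).
  by apply: (vposZ BL); [rewrite exprn_ge0// invr_ge0|have [] := hxN k].
have cv : cvgn (series v).
  apply: normed_cvg; apply: (series_le_cvg _ _ _ (@half_geometric_cvg R)) => n /=.
  - exact: normr_ge0.
  - by rewrite exprn_ge0// invr_ge0.
  - have h : 0 <= 2^-1 ^+ n.+1 :> R by rewrite exprn_ge0// invr_ge0.
    by rewrite normrZ ger0_norm// ler_piMr//; have [] := hxN n.
set x := limn (series v).
have vx k : v k <~ x.
  (* Only partial sums of more than [k] terms contain [v k], hence the shift by [k.+1]. *)
  apply: (vle_cvg BL (s := fun n => series v (n + k.+1)%N)); last first.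
    by rewrite (cvg_shiftn k.+1 (series v)).
  move=> n; rewrite /series /= (bigD1_seq k) ?mem_index_iota ?iota_uniq//=; last first.
    by rewrite addnS ltnS leq_addl.
  rewrite -[v k in X in X <~ _]addr0; apply: (vleD BL); first exact: (vle_refl BL).
  elim/big_ind: _ => //; first exact: (vpos0 BL).
    exact: (vposD BL).
  by move=> i _; exact: v0.
have x0 : vpos x by apply: (vle_trans BL (v0 0)); exact: vx.
(* As [x] dominates every [v k], the series at [x] is at least (4^(k+1) / 2^(k+1))^q, which exceeds
   2^k; this contradicts its convergence. *)
have [k hk] := expr2_unbounded (limn (series (fun n => dabs (ys n) x `^ q))).
move: hk; apply/negP; rewrite -leNgt.
have h2 : 0 <= 2^-1 ^+ k.+1 :> R by rewrite exprn_ge0// invr_ge0.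
have h1 : 1 <= 2 ^+ k.+1 :> R by rewrite exprn_ege1// ler1n.
apply: (@le_trans _ _ ((2 ^+ k.+1) `^ q)).
  apply: (@le_trans _ _ (2 ^+ k.+1)); last by apply: le1r_powR => //; exact: ltW.
  by rewrite exprS ler_peMl ?exprn_ge0// ler1n.
have [xk0 xk1 xkN] := hxN k.
apply: le_trans (@nneg_series_le_lim _ _ (xN k).2 _ (cy x x0)); last first.
  by move=> n; exact: powR_ge0.
have -> : 2 ^+ k.+1 = 2^-1 ^+ k.+1 * 4 ^+ k.+1 :> R.
  by rewrite -exprMn; congr (_ ^+ _); lra.
rewrite powRM ?exprn_ge0//.
apply: (@le_trans _ _ ((2^-1 ^+ k.+1) `^ q *
    \sum_(0 <= n < (xN k).2) absseq ys n (xN k).1 `^ q)).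
  by rewrite ler_wpM2l ?powR_ge0// ltW.
rewrite mulr_sumr; apply: ler_sum => n _.
rewrite -powRM//; last exact: pdual_ge0.
apply: ge0_ler_powR; rewrite ?nnegrE ?(ltW q0)//.
- by rewrite mulr_ge0//; exact: pdual_ge0.
- by rewrite (pdual_ge0 _ pA).
rewrite -(dual_eltZ _ _ (pA.1 n)).
exact: (pos_dual_mono BL (pA.1 n) (pA.2 n) (vx k)).
Qed.

Lemma wbnd_scale C ys x N : pdual ys -> 0 <= C -> wbnd C ys -> vpos x ->
  \sum_(0 <= n < N) ys n x `^ q <= (C * (`|x| + 1)) `^ q.
Proof.
(* Adding 1 to the norm keeps the normalising factor nonzero when [x = 0]. *)
move=> py C0 wy x0; set t := `|x| + 1.
have t0 : 0 < t by rewrite ltr_wpDl.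
have it0 : 0 <= t^-1 by rewrite invr_ge0 ltW.
have y0 : vpos (t^-1 *: x) by exact: (vposZ BL).
have yn : `|t^-1 *: x| <= 1.
  by rewrite normrZ ger0_norm// mulrC ler_pdivrMr// mul1r lerDl.
have -> : \sum_(0 <= n < N) ys n x `^ q =
    t `^ q * \sum_(0 <= n < N) ys n (t^-1 *: x) `^ q.
  rewrite mulr_sumr; apply: eq_bigr => n _.
  rewrite -powRM ?(ltW t0) ?(pdual_ge0 _ py)// (dual_eltZ _ _ (py.1 n)).
  by rewrite mulVKf// gt_eqF.
rewrite powRM ?(ltW t0)// mulrC ler_wpM2r ?powR_ge0//; exact: wy.
Qed.

Lemma ellw_of_wbnd C ys : (forall n, dual_elt (ys n)) -> 0 <= C ->
  wbnd C (absseq ys) -> ellw le q ys.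
Proof.
move=> dy C0 wy; split=> // x x0.
apply: (nneg_series_cvg (M := (C * (`|x| + 1)) `^ q)) => [n|N].
  exact: powR_ge0.
by apply: (wbnd_scale N (pdual_absseq dy)).
Qed.

Let wset ys := [set (limn (series (fun n => dabs (ys n) x `^ q))) `^ q^-1
      | x in [set x | vpos x /\ `|x| <= 1]].

Let powRVK (a : R) : 0 <= a -> (a `^ q) `^ q^-1 = a.
Proof. by move=> a0; rewrite -powRrM divff ?gt_eqF// powRr1. Qed.

Let powRKV (a : R) : 0 <= a -> (a `^ q^-1) `^ q = a.
Proof. by move=> a0; rewrite -powRrM mulVf ?gt_eqF// powRr1. Qed.

Let wset_ub C ys : ellw le q ys -> 0 <= C -> wbnd C (absseq ys) ->
  ubound (wset ys) C.
Proof.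
move=> [dy cy] C0 wy _ [x [x0 nx] <-].
rewrite -[leRHS]powRVK//; apply: ge0_ler_powR; rewrite ?nnegrE ?powR_ge0//.
- by rewrite invr_ge0 ltW.
- apply: le_trans (@nneg_series_le_lim _ _ 0 _ (cy x x0)); first by rewrite big_geq.
  by move=> n; exact: powR_ge0.
by apply: series_lim_le => [|N]; [exact: cy|exact: wy].
Qed.

Let wset0 ys : wset ys !=set0.
Proof.
by eexists; exists 0 => //; split; [exact: (vpos0 BL)|rewrite normr0].
Qed.

Lemma ellw_norm_le C ys : ellw le q ys -> 0 <= C -> wbnd C (absseq ys) ->
  ellw_norm le q ys <= C.
Proof. by move=> ey C0 wy; apply: ge_sup; [exact: wset0|exact: wset_ub]. Qed.

Lemma ellw_norm_ub ys x : ellw le q ys -> vpos x -> `|x| <= 1 ->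
  (limn (series (fun n => dabs (ys n) x `^ q))) `^ q^-1 <= ellw_norm le q ys.
Proof.
move=> ey x0 nx; have [C C0 wy] := ellw_bounded ey.
apply: ub_le_sup; first by exists C; exact: wset_ub.
by exists x.
Qed.

Lemma ellw_norm_ge0 ys : ellw le q ys -> 0 <= ellw_norm le q ys.
Proof.
move=> ey; apply: le_trans (@ellw_norm_ub _ 0 ey _ _); first exact: powR_ge0.
  exact: (vpos0 BL).
by rewrite normr0.
Qed.

Lemma ellw_norm_wbnd ys : ellw le q ys -> wbnd (ellw_norm le q ys) (absseq ys).
Proof.
move=> ey x x0 nx N; have [dy cy] := ey.
have h n : 0 <= dabs (ys n) x `^ q by exact: powR_ge0.
apply: (le_trans (nneg_series_le_lim N h (cy x x0))).
have l0 : 0 <= limn (series (fun n => dabs (ys n) x `^ q)).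
  by apply: le_trans (nneg_series_le_lim 0 h (cy x x0)); rewrite big_geq.
rewrite -[leLHS]powRKV//; apply: ge0_ler_powR; rewrite ?nnegrE ?powR_ge0//.
- exact: ltW.
- exact: ellw_norm_ge0.
exact: ellw_norm_ub.
Qed.

Lemma ellw_absseq ys : ellw le q ys -> ellw le q (absseq ys).
Proof.
move=> ey; have pA := pdual_absseq ey.1.
apply: (@ellw_of_wbnd (ellw_norm le q ys)); first exact: pA.1.
  exact: ellw_norm_ge0.
by rewrite absseq_pos//; exact: ellw_norm_wbnd.
Qed.

Definition wball ys := pdual ys /\ wbnd 1 ys.

(** Lets the supremum in [ellpi_norm] be handled over a set described by finite sums alone, without
    moduli, limits or suprema. *)
Lemma wballP ys : (ellw le q ys /\ dseq_pos le ys /\ ellw_norm le q ys <= 1) <->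
  wball ys.
Proof.
split=> [[ey [y0 ny]]|[py wy]].
  have py : pdual ys by split=> //; exact: ey.1.
  split=> // x x0 nx N; have := ellw_norm_wbnd ey x0 nx N.
  rewrite absseq_pos// => /le_trans; apply.
  by apply: ge0_ler_powR; rewrite ?nnegrE ?ellw_norm_ge0// ltW.
have ey : ellw le q ys.
  by apply: (ellw_of_wbnd py.1 ler01); rewrite absseq_pos.
split=> //; split; first exact: py.2.
by apply: ellw_norm_le => //; rewrite absseq_pos.
Qed.

Lemma pdualZ (a : R) ys : 0 <= a -> pdual ys -> pdual (fun n x => a * ys n x).
Proof.
move=> a0 [dy y0]; split=> n; last by move=> x x0; rewrite mulr_ge0// y0.
have [K K0 hK] := dual_elt_bounded (dy n).
apply: (@bounded_dual_elt _ _ _ (a * K)) => [b x y|x].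
  by rewrite (dy n).1; ring.
by rewrite normrM ger0_norm// -mulrA ler_wpM2l.
Qed.

Lemma wballZ C ys : pdual ys -> 0 < C -> wbnd C ys ->
  wball (fun n x => C^-1 * ys n x).
Proof.
move=> py C0 wy; have iC : 0 <= C^-1 by rewrite invr_ge0 ltW.
split; first exact: pdualZ.
move=> x x0 nx N; rewrite powR1.
have -> : \sum_(0 <= n < N) (C^-1 * ys n x) `^ q =
    (\sum_(0 <= n < N) ys n x `^ q) / C `^ q.
  rewrite mulr_suml; apply: eq_bigr => n _.
  by rewrite powRM ?(pdual_ge0 _ py)// powRV ?(ltW C0)// mulrC.
by rewrite ler_pdivrMr ?powR_gt0// mul1r; exact: wy.
Qed.

(** * Positive strongly summable sequences and their norm *)

Definition pbnd (C : R) xs := forall ys, wball ys ->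
  forall N, \sum_(0 <= n < N) ys n (vabs (xs n)) <= C.

(** On the positive unit ball a single term of the q-sum is at most 1; a general [x] is reduced to
    its normalised modulus. *)
Lemma wball_le_norm ys n x : wball ys -> `|ys n x| <= `|x|.
Proof.
move=> [py wy].
have h z : vpos z -> `|z| <= 1 -> ys n z <= 1.
  move=> z0 nz; have := wy z z0 nz n.+1; rewrite powR1.
  move=> /(le_trans (@term_le_sum _ (fun n => ys n z `^ q) n n.+1 _ _)) h.
  rewrite -(powRVK (pdual_ge0 n py z0)) -(powRVK ler01) powR1.
  apply: ge0_ler_powR; rewrite ?nnegrE ?powR_ge0 ?invr_ge0 ?(ltW q0)//.
  by apply: h => // m; exact: powR_ge0.
have [->|x0] := eqVneq x 0; first by rewrite (dual_elt0 (py.1 n)) !normr0.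
have nx0 : 0 < `|x| by rewrite normr_gt0.
have := abs_le_dabs x (py.1 n); rewrite (dabs_pos (py.1 n) (py.2 n)) => /le_trans; apply.
have a0 := vabs_ge0 BL x.
have i0 : 0 <= `|x|^-1 by rewrite invr_ge0 ltW.
have := h (`|x|^-1 *: vabs x) (vposZ BL i0 a0).
rewrite normrZ ger0_norm// (norm_vabs BL) mulVf ?gt_eqF// lexx => /(_ isT).
by rewrite (dual_eltZ _ _ (py.1 n)) ler_pdivrMl// mulr1.
Qed.

(** The sum of the 2^-(k+1) [zs k] stays in the ball by convexity. It collects countably many bad
    test sequences into one, for the gliding hump in [ellpi_bounded]. *)
Lemma series_wball_mix (zs : nat -> nat -> V -> R) : (forall k, wball (zs k)) ->
  exists2 ys, wball ys & forall n x, vpos x -> forall k,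
    2^-1 ^+ k.+1 * zs k n x <= ys n x.
Proof.
move=> wz.
have h0 k : 0 <= 2^-1 ^+ k.+1 :> R by rewrite exprn_ge0// invr_ge0.
pose t n x := fun k => 2^-1 ^+ k.+1 * zs k n x.
have tb n x k : `|t n x k| <= (2^-1 ^+ k.+1) * `|x|.
  by rewrite /t normrM ger0_norm// ler_wpM2l//; exact: wball_le_norm.
have cg x : cvgn (series (fun k => 2^-1 ^+ k.+1 * `|x|)).
  apply: (nneg_series_cvg (M := `|x|)) => [k|N]; first by rewrite mulr_ge0.
  by rewrite -mulr_suml ler_piMl//; exact: half_geometric_le.
have ct n x : cvgn (series (t n x)) by apply: abs_series_cvg (tb n x) (cg x).
have t0 n x k : vpos x -> 0 <= t n x k.
  by move=> x0; rewrite mulr_ge0// (pdual_ge0 _ (wz k).1).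
pose ys n x := limn (series (t n x)).
have dy n : dual_elt (ys n).
  apply: (@bounded_dual_elt _ _ _ 1) => [a x y|x].
    rewrite /ys (_ : t n (a *: x + y) = a *: t n x + t n y).
      have cZ : cvgn (series (a *: t n x)) by exact: is_cvg_seriesZ.
      by rewrite (lim_seriesD cZ (ct n y)) (lim_seriesZ _ (ct n x)).
    apply/funext => k; rewrite /t /= ((wz k).1.1 n).1 mulrDr.
    by rewrite !fctE /= /GRing.scale /= mulrCA.
  rewrite mul1r; apply: (le_trans (lim_series_abs_le (tb n x) (cg x))).
  apply: series_lim_le => // N.
  by rewrite -mulr_suml ler_piMl//; exact: half_geometric_le.
have y0 : dseq_pos le ys.
  move=> n x x0; apply: (le_trans _ (@nneg_series_le_lim _ (t n x) 0 _ _)) => //.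
    by rewrite big_geq.
  by move=> k; exact: t0.
exists ys; last first.
  move=> n x x0 k; apply: (le_trans _ (@nneg_series_le_lim _ (t n x) k.+1 _ _)) => //.
    by apply: (term_le_sum (F := t n x)) => // j; exact: t0.
  by move=> j; exact: t0.
(* The converse of Hoelder makes the bound linear in [ys], so that the sums over [n] and [k] can be
   exchanged before passing to the limit. *)
split=> // x x0 nx N; apply: (finite_hoelder_conv p1 pq) => [n|a a0 ha].
  exact: y0.
have cs : (fun K => \sum_(0 <= n < N) a n * series (t n x) K) @ \oo -->
    \sum_(0 <= n < N) a n * ys n x.
  elim: N {ha} => [|N IH].
    under eq_fun do rewrite big_geq//; rewrite big_geq//; exact: cvg_cst.
  rewrite big_nat_recr//=; under eq_fun do rewrite big_nat_recr//=.
  by apply: cvgD => //; apply: cvgM; [exact: cvg_cst|exact: ct].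
rewrite -(cvg_lim _ cs)//; apply: limr_le; first by apply: cvgP cs.
apply: nearW => K.
have -> : \sum_(0 <= n < N) a n * series (t n x) K =
    \sum_(0 <= k < K) 2^-1 ^+ k.+1 * \sum_(0 <= n < N) a n * zs k n x.
  under eq_bigr do rewrite /series /= mulr_sumr.
  rewrite exchange_big /=; apply: eq_bigr => k _; rewrite mulr_sumr.
  by apply: eq_bigr => n _; rewrite /t mulrCA.
apply: le_trans (half_geometric_le R K); apply: ler_sum => k _.
rewrite ler_piMr//; apply: (finite_hoelder p1 pq) => //.
  by move=> n; exact: (pdual_ge0 _ (wz k).1).
exact: (wz k).2.
Qed.

(** Gliding hump on the dual side: if test sequences exceed 4^(k+1) for every k, their mixture with
    weights 2^-(k+1) has a divergent pairing with [xs]. *)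
Lemma ellpi_bounded xs : ellpi le vsup q xs -> exists C, pbnd C xs.
Proof.
move=> ex; apply: contrapT => unb.
have hump k : exists yN : (nat -> V -> R) * nat, wball yN.1 /\
    4 ^+ k.+1 < \sum_(0 <= n < yN.2) yN.1 n (vabs (xs n)).
  apply: contrapT => nh; apply: unb; exists (4 ^+ k.+1).
  move=> ys wy N; rewrite leNgt; apply/negP => h; apply: nh.
  by exists (ys, N).
have [yN hyN] := choice hump.
have [ys wy hys] := series_wball_mix (fun k => (hyN k).1).
have [ey [y0 _]] := (wballP ys).2 wy.
have := ex ys ey y0.
have yx n : 0 <= ys n (vabs (xs n)) by apply: y0; exact: (vabs_ge0 BL).
under eq_fun do rewrite (ger0_norm (yx _)).
move=> cy; have [k hk] := expr2_unbounded (limn (series (fun n => ys n (vabs (xs n))))).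
move: hk; apply/negP; rewrite -leNgt.
apply: le_trans (nneg_series_le_lim (yN k).2 yx cy).
apply: (@le_trans _ _ (2^-1 ^+ k.+1 * 4 ^+ k.+1)).
  rewrite -exprMn (_ : 2^-1 * 4 = 2); last by lra.
  by rewrite exprS ler_peMl ?exprn_ge0// ler1n.
apply: (@le_trans _ _ (2^-1 ^+ k.+1 * \sum_(0 <= n < (yN k).2) (yN k).1 n (vabs (xs n)))).
  by rewrite ler_wpM2l ?exprn_ge0 ?invr_ge0// ltW//; exact: (hyN k).2.
rewrite mulr_sumr; apply: ler_sum => n _; apply: hys; exact: (vabs_ge0 BL).
Qed.

Lemma wball0 : wball (fun _ _ => 0).
Proof.
split; first split=> n.
- by apply: (@bounded_dual_elt _ _ _ 0) => *; rewrite ?mulr0 ?addr0 ?normr0 ?mul0r.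
- by move=> x _; exact: lexx.
by move=> x _ _ K; rewrite big1 ?powR_ge0// => i _; rewrite powR0// gt_eqF.
Qed.

Lemma pbnd_pair C c xs ys N : pbnd C xs -> pdual ys -> 0 <= c -> wbnd c ys ->
  \sum_(0 <= n < N) ys n (vabs (xs n)) <= c * C.
Proof.
move=> bx py c0 wy.
have C0 : 0 <= C by have := bx _ wball0 0%N; rewrite big_geq.
(* Since [c] may be 0, [ys] is normalised by [c + e] and [e] is then let go to 0. *)
apply: (le_eps_mul C0) => e e0; rewrite -mulrDl.
have ce : 0 < c + e by lra.
have wy' : wbnd (c + e) ys.
  move=> x x0 nx M; apply: (le_trans (wy x x0 nx M)).
  by apply: ge0_ler_powR; rewrite ?nnegrE ?(ltW q0)//; lra.
have := bx _ (wballZ py ce wy') N.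
by rewrite -mulr_sumr ler_pdivrMl.
Qed.

Lemma pbnd_ge0 C xs : pbnd C xs -> 0 <= C.
Proof. by move=> /(_ _ wball0 0%N); rewrite big_geq. Qed.

Lemma ellpi_of_pbnd C xs : pbnd C xs -> ellpi le vsup q xs.
Proof.
move=> bx ys ey y0; have py : pdual ys by split=> //; exact: ey.1.
have yx n : 0 <= ys n (vabs (xs n)) by apply: y0; exact: (vabs_ge0 BL).
under eq_fun do rewrite (ger0_norm (yx _)).
have := ellw_norm_wbnd ey; rewrite absseq_pos// => wy.
apply: (nneg_series_cvg yx) => N.
exact: (pbnd_pair N bx py (ellw_norm_ge0 ey) wy).
Qed.

Let piset xs := [set limn (series (fun n => ys n (vabs (xs n))))
      | ys in [set ys | ellw le q ys /\ dseq_pos le ys /\ ellw_norm le q ys <= 1]].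

Let wball_cvg xs ys : ellpi le vsup q xs -> wball ys ->
  cvgn (series (fun n => ys n (vabs (xs n)))).
Proof.
move=> ex wy; have [ey [y0 _]] := (wballP ys).2 wy.
have := ex ys ey y0.
by under eq_fun do rewrite (ger0_norm (y0 _ _ (vabs_ge0 BL _))).
Qed.

Let piset_ub C xs : ellpi le vsup q xs -> pbnd C xs -> ubound (piset xs) C.
Proof.
move=> ex bx _ [ys /= /wballP wy <-].
by apply: series_lim_le; [exact: wball_cvg|exact: bx].
Qed.

Lemma ellpi_norm_le C xs : pbnd C xs -> ellpi_norm le vsup q xs <= C.
Proof.
move=> bx; apply: ge_sup; last by apply: piset_ub => //; exact: ellpi_of_pbnd bx.
by eexists; exists (fun _ _ => 0) => //; apply/wballP; exact: wball0.
Qed.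

Lemma ellpi_norm_pbnd xs : ellpi le vsup q xs ->
  pbnd (ellpi_norm le vsup q xs) xs.
Proof.
move=> ex ys wy N.
apply: le_trans (nneg_series_le_lim N _ (wball_cvg ex wy)) _.
  by move=> n; apply: (pdual_ge0 _ wy.1); exact: (vabs_ge0 BL).
have [C bx] := ellpi_bounded ex.
apply: ub_le_sup; first by exists C; exact: piset_ub.
by exists ys => //; apply/wballP.
Qed.

Lemma ellpi_norm_ge0 xs : ellpi le vsup q xs -> 0 <= ellpi_norm le vsup q xs.
Proof. by move=> /ellpi_norm_pbnd/pbnd_ge0. Qed.

(** * The pairing and the isometry *)

Lemma pairing_cvg ys xs : ellw le q ys -> ellpi le vsup q xs ->
  cvgn (series (fun n => absseq ys n (vabs (xs n)))).
Proof.
move=> ey ex; have pA := pdual_absseq ey.1.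
have := ex _ (ellw_absseq ey) pA.2.
by under eq_fun do rewrite (ger0_norm (pA.2 _ _ (vabs_ge0 BL _))).
Qed.

Lemma Tmap_cvg ys xs : ellw le q ys -> ellpi le vsup q xs ->
  cvgn (series (fun n => ys n (xs n))).
Proof.
move=> ey ex; apply: abs_series_cvg (pairing_cvg ey ex) => n.
exact: (abs_le_dabs _ (ey.1 n)).
Qed.

Lemma Tmap_norm_le ys xs : ellw le q ys -> ellpi le vsup q xs ->
  `|Tmap ys xs| <= ellw_norm le q ys * ellpi_norm le vsup q xs.
Proof.
move=> ey ex; have pA := pdual_absseq ey.1.
apply: (@le_trans _ _ (limn (series (fun n => absseq ys n (vabs (xs n)))))).
  apply: lim_series_abs_le (pairing_cvg ey ex) => n.
  exact: (abs_le_dabs _ (ey.1 n)).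
apply: series_lim_le (pairing_cvg ey ex) _ => N.
apply: pbnd_pair => //; first exact: ellpi_norm_pbnd.
  exact: ellw_norm_ge0.
exact: ellw_norm_wbnd.
Qed.

Lemma Tmap_pidual ys : ellw le q ys -> pidual le vsup q (Tmap ys).
Proof.
move=> ey; split=> [a xs xs' ex ex'|]; last first.
  by exists (ellw_norm le q ys) => xs; exact: Tmap_norm_le.
have c1 := Tmap_cvg ey ex; have c2 := Tmap_cvg ey ex'.
have cZ : cvgn (series (a *: _)) := is_cvg_seriesZ c1.
rewrite /Tmap (_ : (fun n => _) =
    a *: (fun n => ys n (xs n)) + (fun n => ys n (xs' n))).
  by rewrite (lim_seriesD cZ c2) (lim_seriesZ _ c1).
by apply/funext => n; rewrite (ey.1 n).1.
Qed.

Lemma Tmap_linear (a : R) ys zs xs : ellw le q ys -> ellw le q zs ->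
  ellpi le vsup q xs ->
  Tmap (fun n x => a * ys n x + zs n x) xs = a * Tmap ys xs + Tmap zs xs.
Proof.
move=> ey ez ex; have c1 := Tmap_cvg ey ex; have c2 := Tmap_cvg ez ex.
have cZ : cvgn (series (a *: _)) := is_cvg_seriesZ c1.
by rewrite /Tmap -[RHS]/(a *: _ + _) -(lim_seriesZ _ c1) -(lim_seriesD cZ c2).
Qed.

Lemma Tmap_finite ys xs N : (forall n, dual_elt (ys n)) ->
  (forall n, (N <= n)%N -> xs n = 0) ->
  Tmap ys xs = \sum_(0 <= n < N) ys n (xs n).
Proof.
move=> dy x0; apply/lim_near_cst => //; exists N => // M /= NM.
rewrite /series /= (big_cat_nat (leq0n _) NM)//= [X in _ + X]big_nat [X in _ + X]big1 ?addr0//.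
by move=> n /andP[Nn _]; rewrite x0// (dual_elt0 (dy n)).
Qed.

(* Every bound on the weighted test sequences [a_n u_n], [|u_n| <= x], is a
   bound on the weak norm: [|ys n| x] is the supremum of the [ys n u]. *)
Lemma wbnd_of_tests C ys : (forall n, dual_elt (ys n)) ->
  (forall N xs, (forall n, (N <= n)%N -> xs n = 0) -> pbnd 1 xs ->
     \sum_(0 <= n < N) ys n (xs n) <= C) ->
  wbnd C (absseq ys).
Proof.
move=> dy test x x0 nx N; have pA := pdual_absseq dy.
apply: (finite_hoelder_conv p1 pq) => [n|a a0 ha]; first exact: pdual_ge0.
have A0 : 0 <= \sum_(0 <= n < N) a n by apply: sumr_ge0.
(* Replacing each modulus at [x] by a value [ys n (u n)] up to [e] costs [e] times the sum of the
   [a n]. *)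
apply: (le_eps_mul A0) => e e0.
have approx n : exists u, vabs u <~ x /\ absseq ys n x - e < ys n u.
  by have [u ux hu] := dabs_approx (dy n) x0 e0; exists u.
have [u hu] := choice approx.
apply: (@le_trans _ _ (\sum_(0 <= n < N) (a n * ys n (u n) + e * a n))).
  apply: ler_sum => n _; rewrite [e * _]mulrC -mulrDr ler_wpM2l// -lerBlDr.
  by apply: ltW; have [] := hu n.
rewrite big_split /= -mulr_sumr lerD2r.
pose xs n := if (n < N)%N then a n *: u n else 0.
have -> : \sum_(0 <= n < N) a n * ys n (u n) = \sum_(0 <= n < N) ys n (xs n).
  by apply: eq_big_nat => n /andP[_ nN]; rewrite /xs nN (dual_eltZ _ _ (dy n)).
apply: test => [n Nn|zs [pz wz] M]; first by rewrite /xs ltnNge Nn.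
(* The modulus of [a n *: u n] is at most [a n *: x], so Hoelder against [zs] puts the test sequence
   in the unit ball. *)
have hz n : zs n (vabs (xs n)) <= if (n < N)%N then a n * zs n x else 0.
  rewrite /xs; case: ifP => _; last by rewrite (vabs0 BL) (dual_elt0 (pz.1 n)).
  rewrite -(dual_eltZ _ _ (pz.1 n)).
  apply: (pos_dual_mono BL (pz.1 n) (pz.2 n)); have [ux _] := hu n.
  apply: (vabs_le BL).
    by apply: (bl_scale BL (a0 n)); exact: (vle_trans BL (vle_absr BL _) ux).
  rewrite -scalerN; apply: (bl_scale BL (a0 n)).
  exact: (vle_trans BL (vle_absNr BL _) ux).
apply: (le_trans (ler_sum _ (fun n _ => hz n))).
apply: (le_trans (sum_trunc_le _ _ _)) => [n|].
  by rewrite mulr_ge0// (pdual_ge0 _ pz).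
apply: (finite_hoelder p1 pq) => // [n|]; first exact: (pdual_ge0 _ pz).
exact: wz.
Qed.

(** One inequality is [Tmap_norm_le]. For the other, the operator norm bounds the pairing with every
    test sequence, so it is an admissible constant in [wbnd_of_tests]. *)
Lemma Tmap_isometry ys : ellw le q ys ->
  pidual_norm le vsup q (Tmap ys) = ellw_norm le q ys.
Proof.
move=> ey; have w0 := ellw_norm_ge0 ey.
have ub : ubound [set `|Tmap ys xs| | xs in
    [set xs | ellpi le vsup q xs /\ ellpi_norm le vsup q xs <= 1]]
    (ellw_norm le q ys).
  move=> _ [xs [ex nx] <-]; apply: (le_trans (Tmap_norm_le ey ex)).
  by rewrite ler_piMr.
have mem xs : pbnd 1 xs -> `|Tmap ys xs| <= pidual_norm le vsup q (Tmap ys).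
  move=> bx; apply: ub_le_sup; first by exists (ellw_norm le q ys).
  exists xs => //; split; first exact: ellpi_of_pbnd bx.
  exact: ellpi_norm_le.
have b0 : pbnd 1 (fun _ => 0).
  by move=> zs [pz _] N; rewrite big1// => n _; rewrite (vabs0 BL) (dual_elt0 (pz.1 n)).
apply/le_anti/andP; split.
  apply: ge_sup => //; exists `|Tmap ys (fun _ => 0)|, (fun _ => 0) => //.
  by split; [exact: ellpi_of_pbnd b0|exact: ellpi_norm_le].
apply: ellw_norm_le => //; first by apply: le_trans (mem _ b0).
apply: wbnd_of_tests; first exact: ey.1.
move=> N xs x0 bx; rewrite -(Tmap_finite ey.1 x0).
exact: le_trans (ler_norm _) (mem _ bx).
Qed.

(** * Density of the finite sequences: tails are small in norm *)

Definition tail N xs : nat -> V := fun n => if (n < N)%N then 0 else xs n.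

(* Gluing [m] disjoint blocks of unit-ball sequences costs only [m^(1/q)] in
   norm, whereas each block contributes [e] to the pairing with [xs]. *)
Lemma disjoint_blocks xs (e : R) : 0 < e -> (forall N, ~ pbnd e (tail N xs)) ->
  forall m N, exists ws M, [/\ pdual ws, forall n x, (n < N)%N -> ws n x = 0,
    forall x, vpos x -> `|x| <= 1 -> forall K,
      \sum_(0 <= n < K) ws n x `^ q <= m%:R &
    m%:R * e <= \sum_(0 <= n < M) ws n (vabs (xs n))].
Proof.
move=> e0 ntail; elim=> [|m IH] N.
  exists (fun _ _ => 0), 0%N; split=> //.
  - by have [] := wball0.
  - by move=> x _ _ K; rewrite big1// => i _; rewrite powR0// gt_eqF.
  - by rewrite mul0r big_geq.
have [ys [wy [L hL]]] : exists ys, wball ys /\ exists L,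
    e < \sum_(0 <= n < L) ys n (vabs (tail N xs n)).
  apply: contrapT => h; apply: (ntail N) => ys wy M.
  by rewrite leNgt; apply/negP => lt; apply: h; exists ys; split=> //; exists M.
have [py wy1] := wy.
have y0 n := pdual_ge0 n py (vabs_ge0 BL (tail N xs n)).
pose M := (L + N)%N; have NM : (N <= M)%N by exact: leq_addl.
have hM := lt_le_trans hL (sum_nneg_mono y0 (leq_addr N L)).
(* The remaining blocks start at [M], where the block taken from [ys] on [N, M) ends; hence the
   supports are disjoint. *)
have [zs [K [pz z0 zw zK]]] := IH M.
pose ws n := if (n < N)%N then (fun _ => 0) else if (n < M)%N then ys n else zs n.
exists ws, (M + K)%N; split.
- rewrite /ws; split=> n; case: ifP => _.
  + exact: (wball0.1.1 n).
  + by case: ifP => _; [exact: py.1|exact: pz.1].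
  + by move=> x _; exact: lexx.
  + by case: ifP => _; [exact: py.2|exact: pz.2].
- by move=> n x nN; rewrite /ws nN.
- move=> x x0 nx J.
  apply: (@le_trans _ _ (\sum_(0 <= n < J) (ys n x `^ q + zs n x `^ q))).
    apply: ler_sum => n _; rewrite /ws; case: ifP => _.
      by rewrite powR0 ?gt_eqF// addr_ge0// powR_ge0.
    by case: ifP => _; rewrite ?lerDl ?lerDr powR_ge0.
  rewrite big_split /= -natr1 addrC lerD//; first exact: zw.
  by have := wy1 x x0 nx J; rewrite powR1.
have zx0 n := pdual_ge0 n pz (vabs_ge0 BL (xs n)).
rewrite -natr1 mulrDl mul1r addrC.
apply: (@le_trans _ _ (\sum_(0 <= n < M + K) ((if (n < M)%N then
    ys n (vabs (tail N xs n)) else 0) + zs n (vabs (xs n))))).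
  rewrite big_split lerD//=.
    apply: le_trans (ltW hM) _.
    rewrite (big_cat_nat (leq0n _) (leq_addr K M))//=.
    rewrite [X in X + _](eq_big_nat _ _ (F2 := fun n => ys n (vabs (tail N xs n)))).
      by rewrite lerDl sumr_ge0// => n _; case: ifP.
    by move=> n /andP[_ ->].
  by apply: (le_trans zK); apply: sum_nneg_mono => //; exact: leq_addl.
apply: ler_sum => n _; rewrite /ws /tail.
have [nM|Mn] := ltnP n M.
  rewrite z0// addr0; case: ifP => _ //.
  by rewrite (vabs0 BL) (dual_elt0 (py.1 n)).
by rewrite add0r ltnNge (leq_trans NM Mn).
Qed.

Lemma tail_small xs (e : R) : ellpi le vsup q xs -> 0 < e ->
  exists N, pbnd e (tail N xs).
Proof.
move=> ex e0; apply: contrapT => h.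
have ntail N : ~ pbnd e (tail N xs) by move=> hN; apply: h; exists N.
set C := ellpi_norm le vsup q xs.
have C0 : 0 <= C by exact: ellpi_norm_ge0.
have p0 : 0 < p by move: p1; lra.
(* The blocks give m e <= m^(1/q) C, that is m <= (C/e)^p; this [m] is chosen to exceed that
   bound. *)
pose m := (Num.truncn ((C / e) `^ p)).+1.
have m0 : 0 < m%:R :> R by rewrite ltr0n.
have [ws [M [pw _ ww wM]]] := disjoint_blocks e0 ntail m 0.
have wbw : wbnd (m%:R `^ q^-1) ws.
  by move=> x x0 nx K; rewrite powRKV ?ler0n//; exact: ww.
have := le_trans wM (pbnd_pair M (ellpi_norm_pbnd ex) pw (powR_ge0 _ _) wbw).
rewrite -/C => le1.
have le2 : m%:R `^ p^-1 <= C / e.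
  have -> : p^-1 = 1 - q^-1 by move: pq; lra.
  rewrite powRB ?(gt_eqF m0) ?implybT// powRr1 ?ler0n//.
  by rewrite ler_pdivlMr// mulrAC ler_pdivrMr ?powR_gt0// [C * _]mulrC.
have : m%:R <= (C / e) `^ p.
  have -> : m%:R = (m%:R `^ p^-1) `^ p.
    by rewrite -powRrM mulVf ?gt_eqF// powRr1 ?ler0n.
  apply: ge0_ler_powR; rewrite ?nnegrE ?powR_ge0 ?(ltW p0)//.
  by rewrite divr_ge0// ltW.
by rewrite leNgt => /negP; apply; exact: truncnS_gt.
Qed.

(** * Single entries, truncations and tails as elements of l_p^pi *)

Definition single n x : nat -> V := fun m => if m == n then x else 0.

Definition trunc N xs : nat -> V := fun n => if (n < N)%N then xs n else 0.

Lemma single_pbnd n x : pbnd `|x| (single n x).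
Proof.
move=> ys wy N; have [py _] := wy.
have -> : \sum_(0 <= m < N) ys m (vabs (single n x m)) =
    \sum_(0 <= m < N) (if m == n then ys n (vabs x) else 0).
  apply: eq_bigr => m _; rewrite /single; case: eqP => [->//|_].
  by rewrite (vabs0 BL) (dual_elt0 (py.1 m)).
rewrite -big_mkcond /= big_nat1_eq; case: ifP => _; last exact: normr_ge0.
rewrite -(norm_vabs BL x); apply: le_trans (ler_norm _) _.
exact: wball_le_norm.
Qed.

Lemma single_ellpi n x : ellpi le vsup q (single n x).
Proof. exact: ellpi_of_pbnd (single_pbnd n x). Qed.

Lemma finite_ellpi N xs : (forall n, (N <= n)%N -> xs n = 0) ->
  ellpi le vsup q xs.
Proof.
move=> x0; apply: (@ellpi_of_pbnd (\sum_(0 <= n < N) `|xs n|)) => ys wy M.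
apply: le_trans (sum_trunc_le M N (fun n => normr_ge0 (xs n))).
apply: ler_sum => n _; case: ltnP => [_|/x0 ->]; last first.
  by rewrite (vabs0 BL) (dual_elt0 (wy.1.1 n)).
rewrite -(norm_vabs BL (xs n)); apply: le_trans (ler_norm _) _.
exact: wball_le_norm.
Qed.

Lemma tail_ellpi N xs : ellpi le vsup q xs -> ellpi le vsup q (tail N xs).
Proof.
move=> ex; have [C bx] := ellpi_bounded ex; apply: (@ellpi_of_pbnd C) => ys wy M.
apply: le_trans (bx ys wy M); apply: ler_sum => n _; rewrite /tail.
case: ifP => // _; rewrite (vabs0 BL) (dual_elt0 (wy.1.1 n)).
by apply: (pdual_ge0 _ wy.1); exact: (vabs_ge0 BL).
Qed.

Lemma trunc_ellpi N xs : ellpi le vsup q (trunc N xs).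
Proof. by apply: (@finite_ellpi N) => n Nn; rewrite /trunc ltnNge Nn. Qed.

(** * Surjectivity: a bounded functional is the pairing with its coordinates *)

Section Onto.
Variable phi : (nat -> V) -> R.
Hypothesis dphi : pidual le vsup q phi.

Let lin := dphi.1.

(** The constant in [pidual] may be negative; its absolute value allows the norm to be replaced by
    any [pbnd] bound. *)
Let phi_bounded : exists2 K, 0 <= K &
  forall C xs, pbnd C xs -> `|phi xs| <= K * C.
Proof.
have [K hK] := dphi.2; exists `|K| => // C xs bx.
apply: (le_trans (hK _ (ellpi_of_pbnd bx))).
apply: (@le_trans _ _ (`|K| * ellpi_norm le vsup q xs)).
  by rewrite ler_wpM2r ?ler_norm//; apply: ellpi_norm_ge0; exact: ellpi_of_pbnd bx.
by rewrite ler_wpM2l//; exact: ellpi_norm_le.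
Qed.

Definition coords : nat -> V -> R := fun n x => phi (single n x).

Lemma coords_dual n : dual_elt (coords n).
Proof.
have [K K0 hK] := phi_bounded.
apply: (@bounded_dual_elt _ _ _ K) => [a x y|x]; last exact/hK/single_pbnd.
rewrite /coords -(lin a (@single_ellpi n x) (@single_ellpi n y)); congr phi.
by apply/funext => m; rewrite /single; case: eqP => // _; rewrite scaler0 addr0.
Qed.

Lemma phi_trunc N xs : phi (trunc N xs) = \sum_(0 <= n < N) coords n (xs n).
Proof.
elim: N => [|N IH].
  (* Linearity at the zero sequence [trunc 0 xs] reads phi(0) = phi(0) + phi(0). *)
  rewrite big_geq//; have e0 := @trunc_ellpi 0 xs; have := lin 1 e0 e0.
  have -> : (fun n => 1 *: trunc 0 xs n + trunc 0 xs n) = trunc 0 xs.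
    by apply/funext => n; rewrite /trunc scaler0 addr0.
  lra.
have := lin 1 (@trunc_ellpi N xs) (@single_ellpi N (xs N)).
rewrite big_nat_recr//= -IH mul1r => <-.
congr phi; apply/funext => n; rewrite /trunc /single ltnS leq_eqVlt scale1r.
by case: eqP => [->|_] /=; [rewrite ltnn add0r|rewrite addr0].
Qed.

Lemma coords_ellw : ellw le q coords.
Proof.
have [K K0 hK] := phi_bounded.
apply: (ellw_of_wbnd coords_dual K0); apply: (wbnd_of_tests coords_dual).
move=> N xs x0 bx; rewrite -phi_trunc (_ : trunc N xs = xs).
  by apply: (le_trans (ler_norm _)); have := hK _ _ bx; rewrite mulr1.
by apply/funext => n; rewrite /trunc; case: ltnP => // /x0.
Qed.

(** The partial sums of the pairing are the values of [phi] on truncations; the error is [phi] of a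
    tail, which [tail_small] controls. *)
Lemma Tmap_coords xs : ellpi le vsup q xs -> phi xs = Tmap coords xs.
Proof.
move=> ex; have [K K0 hK] := phi_bounded.
have K1 : 0 < K + 1 by lra.
apply/esym/cvg_lim => //; apply/cvgrPdist_le => e e0.
have [N bN] := tail_small ex (divr_gt0 e0 K1).
exists N => // M /= NM; rewrite /series /= -phi_trunc.
have -> : phi xs - phi (trunc M xs) = phi (tail M xs).
  have := lin 1 (tail_ellpi (N := M) ex) (@trunc_ellpi M xs); rewrite mul1r => h.
  apply/eqP; rewrite subr_eq -h; apply/eqP; congr phi; apply/funext => n; rewrite /tail /trunc scale1r.
  by case: ifP; rewrite ?add0r ?addr0.
(* A later tail is dominated entrywise by the tail at [N]. *)
have bM : pbnd (e / (K + 1)) (tail M xs).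
  move=> ys wy L; apply: le_trans (bN ys wy L); apply: ler_sum => n _.
  rewrite /tail; case: (ltnP n M) => [_|Mn]; last by rewrite ltnNge (leq_trans NM Mn).
  rewrite (vabs0 BL) (dual_elt0 (wy.1.1 n)).
  by apply: (pdual_ge0 _ wy.1); exact: (vabs_ge0 BL).
apply: (le_trans (hK _ _ bM)); rewrite mulrA ler_pdivrMr// mulrC ler_wpM2l ?ltW//.
lra.
Qed.

End Onto.

(** For minimality, a dominating [chi] is itself a pairing with [coords chi]. Testing it on single
    entries shows that each coordinate dominates [ys n] and its negative, hence the modulus of
    [ys n]. *)
Lemma Tmap_modulus ys : ellw le q ys ->
  is_piabs le vsup q (Tmap ys) (Tmap (absseq ys)).
Proof.
move=> ey; have eA := ellw_absseq ey.
split; first exact: Tmap_pidual.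
split=> [xs ex x0|].
  apply: lim_series_le; [exact: Tmap_cvg|exact: Tmap_cvg|].
  by move=> n; have [_ [h _]] := dabsP (ey.1 n); exact: h.
split=> [xs ex x0|chi dchi le1 le2 xs ex x0].
  rewrite -(lim_seriesN (Tmap_cvg ey ex)); apply: lim_series_le.
  - by rewrite is_cvg_seriesN; exact: Tmap_cvg.
  - exact: Tmap_cvg.
  by move=> n; have [_ [_ [h _]]] := dabsP (ey.1 n); exact: h.
rewrite (Tmap_coords dchi ex); apply: lim_series_le; first exact: Tmap_cvg.
  exact: (Tmap_cvg (coords_ellw dchi) ex).
move=> n; have [_ [_ [_ min]]] := dabsP (ey.1 n).
have T1 x : Tmap ys (single n x) = ys n x.
  rewrite (@Tmap_finite _ _ n.+1 ey.1); last first.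
    by move=> m nm; rewrite /single gtn_eqF.
  rewrite big_nat_recr//= /single eqxx big_nat big1 ?add0r// => m /andP[_ mn].
  by rewrite ltn_eqF// (dual_elt0 (ey.1 m)).
have s0 x : vpos x -> forall m, vpos (single n x m).
  by move=> ? m; rewrite /single; case: eqP => // _; exact: (vpos0 BL).
apply: (min (coords chi n)) => //; first exact: coords_dual.
- by move=> x /s0 sx; rewrite -T1; apply: le1 => //; exact: single_ellpi.
- by move=> x /s0 sx; rewrite -T1; apply: le2 => //; exact: single_ellpi.
Qed.

End SequenceSpaces.

Theorem theorem1p3 (R : realType) (V : completeNormedModType R)
  (le : V -> V -> Prop) (vsup : V -> V -> V) (p q : R) :
  banach_lattice le vsup -> 1 < p -> p^-1 + q^-1 = 1 ->
  (* the defining series converges, so the map is well defined *)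
  (forall ys xs, ellw le q ys -> ellpi le vsup q xs ->
     cvgn (series (fun n => ys n (xs n)))) /\
  (* it lands in the dual of ell_p^pi(X) *)
  (forall ys, ellw le q ys -> pidual le vsup q (Tmap ys)) /\
  (* it is linear *)
  (forall (a : R) ys zs xs, ellw le q ys -> ellw le q zs ->
     ellpi le vsup q xs ->
     Tmap (fun n x => a * ys n x + zs n x) xs = a * Tmap ys xs + Tmap zs xs) /\
  (* it is an isometry *)
  (forall ys, ellw le q ys ->
     pidual_norm le vsup q (Tmap ys) = ellw_norm le q ys) /\
  (* it is onto *)
  (forall phi, pidual le vsup q phi ->
     exists2 ys, ellw le q ys &
       forall xs, ellpi le vsup q xs -> phi xs = Tmap ys xs) /\
  (* it is a lattice homomorphism: T(|ys|) = |T ys| *)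
  (forall ys, ellw le q ys ->
     is_piabs le vsup q (Tmap ys) (Tmap (fun n => dabs le (ys n)))).
Proof.
move=> BL p1 pq; split; [|split; [|split; [|split; [|split]]]].
- by move=> ys xs; exact: (Tmap_cvg BL p1 pq).
- by move=> ys; exact: (Tmap_pidual BL p1 pq).
- by move=> a ys zs xs; exact: (Tmap_linear BL p1 pq).
- by move=> ys; exact: (Tmap_isometry BL p1 pq).
- move=> phi dphi; exists (coords phi); first exact: (coords_ellw BL p1 pq).
  by move=> xs; exact: (Tmap_coords BL p1 pq).
- by move=> ys; exact: (Tmap_modulus BL p1 pq).
Qed.
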